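(* Let $p$ be a prime, let $G=\mathbb Z/p\mathbb Z$, let $\Gamma=(V,E,\mathrm{wt},\nu)$ be an edge-weighted $G$-voltage directed multigraph, and let $\mathscr L(\Gamma)$ be its voltage Laplacian matrix, with entries in $\mathbb Z[\zeta_p][E]$. Then for any vertex $v$ of $\Gamma$ with $A_v(\Gamma)\ne0$ and any lift $\tilde v$ of $v$ in the derived graph $\tilde\Gamma$ of $\Gamma$, $$\frac{A_{\tilde v}(\tilde\Gamma)}{A_v(\Gamma)}=\frac1{|G|}N_{\mathbb Q(\zeta_p)/\mathbb Q}\bigl(\det[\mathscr L(\Gamma)]\bigr)=\frac1{|G|}\prod_{i=1}^{p-1}\det[\sigma_i(\mathscr L(\Gamma))],$$ where $N_{\mathbb Q(\zeta_p)/\mathbb Q}$ denotes the field norm of $\mathbb Q(\zeta_p)$ over $\mathbb Q$, naturally extended to a norm on $\mathbb Q(\zeta_p)[E]$, and $\sigma_i$ is the field automorphism of $\mathbb Q(\zeta_p)$ with $\zeta_p\mapsto\zeta_p^i$ (applied to coefficients).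
   Context: Graphs are finite directed multigraphs (loops and multiple edges allowed). The edge weights $\mathrm{wt}(e)$, $e\in E$, of $\Gamma$ are distinct indeterminates; $R[E]$ denotes the polynomial ring over a ring $R$ in these indeterminates. Label the vertices $v_1,\dots,v_n$; $E_s(v)$ is the set of edges with source $v$, and $e=(v,w)$ means $e$ has source $v$ and target $w$. An arborescence of a graph rooted at $v$ is a spanning tree directed towards $v$ (every vertex has a unique directed path to $v$ in the tree). Its weight is the product of its edge weights, and $A_v(\cdot)$ is the sum of weights of all arborescences rooted at $v$. A $G$-voltage graph is a weighted directed multigraph with a map $\nu:E\to G$ (the voltage). Its derived graph $\tilde\Gamma$ has vertex set $V\times G$ and, for each edge $e=(v,w)$ of $\Gamma$ and each $x\in G$, an edge from $(v,x)$ to $(w,\nu(e)x)$ (group written multiplicatively) of weight $\mathrm{wt}(e)$. A lift of $v$ is a vertex $(v,x)$. The reduced group algebra is $\overline{\mathbb Z[G]}=\mathbb Z[G]/\langle\sum_{g\in G}g\rangle$. For $G=\mathbb Z/p\mathbb Z$ it is identified with $\mathbb Z[\zeta_p]$, $\zeta_p$ a primitive $p$-th root of unity, by sending a fixed generator of $G$ to $\zeta_p$. The voltage Laplacian is $\mathscr L(\Gamma)=D(\Gamma)-\mathscr A(\Gamma)$, where $D(\Gamma)$ is the diagonal matrix with entries $d_{ii}=\sum_{e\in E_s(v_i)}\mathrm{wt}(e)$ and $\mathscr A(\Gamma)$ has entries $a_{ij}=\sum_{e=(v_i,v_j)}\nu(e)\,\mathrm{wt}(e)$, with $\nu(e)$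 viewed in $\overline{\mathbb Z[G]}=\mathbb Z[\zeta_p]$. The extended norm of $f\in\mathbb Q(\zeta_p)[E]$ is the determinant of multiplication by $f$ as a $\mathbb Q[E]$-linear endomorphism of $\mathbb Q(\zeta_p)[E]$. *)

(* Defs.v *)
From HB Require Import structures.
From mathcomp Require Import all_boot all_order all_algebra all_fingroup all_field.
From mathcomp Require Import boolp mpoly.

Set Implicit Arguments.
Unset Strict Implicit.
Unset Printing Implicit Defensive.

Import GRing.Theory.
Local Open Scope ring_scope.

(** * Directed multigraphs and arborescences *)

Record digraph := Digraph {
  vertex : finType;
  edge : finType;
  source : edge -> vertex;
  target : edge -> vertex }.

Section Arborescences.

Variable D : digraph.
Implicit Types (T : {set edge D}) (v w x y : vertex D).

(* The edge list of a directed walk inside T.  In a tree no directed walk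
   repeats a vertex, so that directed walks and directed paths coincide there. *)
Fixpoint dipath T x (s : seq (edge D)) y : bool :=
  if s is e :: s' then [&& e \in T, source e == x & dipath T (target e) s' y]
  else x == y.

(* A pair (e, b) is the edge e traversed forwards if b, and backwards
   otherwise; these are the steps of walks that ignore directions. *)
Definition dart_source (d : edge D * bool) := if d.2 then source d.1 else target d.1.
Definition dart_target (d : edge D * bool) := if d.2 then target d.1 else source d.1.

Fixpoint upath T x (s : seq (edge D * bool)) y : bool :=
  if s is d :: s' then
    [&& d.1 \in T, dart_source d == x & upath T (dart_target d) s' y]
  else x == y.

(* Loops and pairs of parallel or opposite edges are cycles. *)
Definition ucycle_in T (s : seq (edge D * bool)) : Prop :=
  [/\ s != [::], uniq [seq d.1 | d <- s], uniq [seq dart_source d | d <- s]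
    & exists x, upath T x s x].

Definition spanning_tree T : Prop :=
  (forall x y, exists s, upath T x s y) /\ ~ (exists s, ucycle_in T s).

Definition arborescence v T : Prop :=
  spanning_tree T /\ (forall w, exists! s, dipath T w s v).

(* A_v, for edge weights wt in an arbitrary commutative ring. *)
Definition arb_sum (R : comNzRingType) (wt : edge D -> R) v : R :=
  \sum_(T : {set edge D} | `[< arborescence v T >]) \prod_(e in T) wt e.

(* The indeterminates: the edge e is the variable of index [enum_rank e], and
   R[E] is {mpoly R[#|edge D|]}. *)
Definition indet_wt (R : nzRingType) (e : edge D) : {mpoly R[#|edge D|]} :=
  'X_(enum_rank e).

End Arborescences.

(** * Voltage graphs *)

Record voltage_graph (G : finGroupType) := VoltageGraph {
  base :> digraph;
  voltage : edge base -> G }.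

Section Derived.

Variables (G : finGroupType) (Gamma : voltage_graph G).

Definition derived_graph : digraph :=
  @Digraph (vertex Gamma * G)%type (edge Gamma * G)%type
    (fun ex => (source ex.1, ex.2))
    (fun ex => (target ex.1, (voltage ex.1 * ex.2)%g)).

Definition derived_wt (R : Type) (wt : edge Gamma -> R)
    (ex : edge derived_graph) : R :=
  wt ex.1.

End Derived.

Section Laplacian.

Variables (p : nat) (L : fieldExtType rat) (zeta : L).
Variable Gamma : voltage_graph 'Z_p.

(* The image of g in the reduced group algebra Z[zeta], the generator 1 of the
   additive group Z/p being sent to zeta. *)
Definition voltage_val (g : 'Z_p) : L := zeta ^+ (g : nat).

Definition voltage_laplacian :
    'M[{mpoly L[#|edge Gamma|]}]_#|vertex Gamma| :=
  \matrix_(i, j)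
    ((\sum_(e | source e == enum_val i) indet_wt L e) *+ (i == j)
     - \sum_(e | (source e == enum_val i) && (target e == enum_val j))
         (voltage_val (voltage e)) *: indet_wt L e).

End Laplacian.

(** * Norm and Galois conjugation *)

Section ExtendedNorm.

Variables (L : fieldExtType rat) (n : nat).

(* A Q-basis b of L is a Q[E]-basis of L[E], the coordinates of a polynomial
   being obtained by taking those of its coefficients.  The i-th row of the
   matrix holds the coordinates of f * b_i. *)
Definition ext_norm (f : {mpoly L[n]}) : {mpoly rat[n]} :=
  let b := vbasis {:L} in
  \det (\matrix_(i < \dim {:L}, j < \dim {:L})
          map_mpoly (coord b j) (f * (b`_i)%:MP)).

End ExtendedNorm.

(* The automorphism mapping zeta to zeta ^ i, if there is one (see cycl_autE),
   and the identity otherwise.  It is unique when zeta generates L. *)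
Definition cycl_aut (L : fieldExtType rat) (zeta : L) (i : nat) : 'AEnd(L) :=
  if pselect (exists s : 'AEnd(L), s zeta == zeta ^+ i) is left ex_s
  then xchoose ex_s else \1%AF.

Lemma root_Cyclotomic_prime (p : nat) (L : fieldExtType rat) (z : L) :
  prime p -> p.-primitive_root z -> root (map_poly intr 'Phi_p) z.
Proof.
move=> p_pr z_prim; have p_gt0 := prime_gt0 p_pr.
have Phi1 : 'Phi_1 = 'X - 1 :> {poly int}.
  by have := @prod_Cyclotomic 1 isT; rewrite (_ : divisors 1 = [:: 1%N]) // big_seq1.
have Phi_p : ('X - 1) * 'Phi_p = 'X^p - 1 :> {poly int}.
  rewrite -Phi1 -prod_Cyclotomic //.
  rewrite (perm_big [:: 1%N; p]) /=; first by rewrite big_cons big_seq1.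
  apply: uniq_perm; first exact: divisors_uniq.
    by rewrite /= inE andbT neq_ltn prime_gt1.
  by move=> d; rewrite -dvdn_divisors // !inE; apply/idP/idP;
     [case/primeP: p_pr => _; apply | case/orP=> /eqP->; rewrite ?dvd1n].
have /(congr1 (fun q : {poly int} => (map_poly intr q : {poly L}).[z])) := Phi_p.
rewrite rmorphM !rmorphB /= map_polyXn map_polyX !rmorph1 hornerM !hornerE.
rewrite ?hornerXn (prim_expr_order z_prim) subrr => /eqP; rewrite mulf_eq0 => /orP[|//].
rewrite subr_eq0 -[z]expr1 -(prim_order_dvd z_prim) dvdn1 => /eqP p1.
by rewrite p1 in p_pr.
Qed.

Lemma root_minPoly_prim_root (p : nat) (L : fieldExtType rat) (z w : L) :
  prime p -> p.-primitive_root z -> p.-primitive_root w -> root (minPoly 1 z) w.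
Proof.
move=> p_pr z_prim w_prim.
have /polyOver1P[q Dq] := minPolyOver 1 z.
pose P : {poly rat} := map_poly intr 'Phi_p.
have PL : map_poly (in_alg L) P = map_poly intr 'Phi_p.
  by rewrite -map_poly_comp; apply: eq_map_poly => m /=; rewrite scaler_int.
have PC : map_poly ratr P = map_poly intr 'Phi_p :> {poly algC}.
  by rewrite -map_poly_comp; apply: eq_map_poly => m /=; rewrite ratr_int.
have q_dv_P : q %| P.
  rewrite -(dvdp_map (in_alg L)) -Dq; apply: minPoly_dvdp.
    exact: alg_polyOver.
  by rewrite PL root_Cyclotomic_prime.
have [c qc0] : exists c : algC, root (map_poly ratr q) c.
  apply/closed_rootP; rewrite size_map_poly -(size_map_poly (in_alg L)) -Dq.
  by rewrite size_minPoly eqSS -lt0n adjoin_degreeE divn_gt0 ?adim_gt0 ?dimvS ?subv_adjoin.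
have c_prim : p.-primitive_root c.
  have [u u_prim] := C_prim_root_exists (prime_gt0 p_pr).
  rewrite -(root_cyclotomic u_prim) -(Cintr_Cyclotomic u_prim) -PC.
  rewrite -dvdp_XsubCl; rewrite -dvdp_XsubCl in qc0.
  by apply: dvdp_trans qc0 _; rewrite dvdp_map.
have P_dv_q : P %| q.
  have [P' [DP' _] P'_dv] := minCpolyP c.
  rewrite (minCpoly_cyclotomic c_prim) -(Cintr_Cyclotomic c_prim) -PC in DP'.
  suff -> : P = P' by rewrite -P'_dv.
  exact: (map_inj_poly (fmorph_inj (ratr : rat -> algC)) (rmorph0 _)).
suff : root (map_poly intr 'Phi_p) w.
  by rewrite -!dvdp_XsubCl => /dvdp_trans-> //; rewrite Dq -PL dvdp_map.
exact: root_Cyclotomic_prime.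
Qed.

Lemma cycl_autE (p : nat) (L : fieldExtType rat) (zeta : L) (i : nat) :
  prime p -> p.-primitive_root zeta -> <<1; zeta>>%VS = {:L}%VS ->
  (0 < i < p)%N -> cycl_aut zeta i zeta = zeta ^+ i.
Proof.
move=> p_pr zeta_prim genL /andP[i_gt0 i_lt_p].
suff [s Ds] : exists s : 'AEnd(L), s zeta == zeta ^+ i.
  rewrite /cycl_aut; case: pselect => [ex_s | []]; last by exists s.
  exact/eqP/(xchooseP ex_s).
have zi_prim : p.-primitive_root (zeta ^+ i).
  by rewrite prim_root_exp_coprime // coprime_sym prime_coprime // gtnNdvd.
have rt : root (map_poly \1%VF (minPoly 1 zeta)) (zeta ^+ i).
  by rewrite lfun1_poly; apply: root_minPoly_prim_root zi_prim.
have := kHomExtendP (subvv _) (kHom1 1 1) rt.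
have := kHomExtend_val (kHom1 1 1) rt.
set s := kHomExtend _ _ _ _ => Ds.
rewrite genL k1HomE => s_ahom; exists (AHom s_ahom); exact/eqP.
Qed.

(* Main.v *)
Require Import Defs.
From HB Require Import structures.
From mathcomp Require Import all_boot all_order all_algebra all_fingroup all_field.
From mathcomp Require Import boolp mpoly.

Set Implicit Arguments.
Unset Strict Implicit.
Unset Printing Implicit Defensive.

Import GRing.Theory.
Local Open Scope ring_scope.

(** By the directed matrix-tree theorem ([matrix_tree]), A_v is the determinant
    of the Laplacian whose row v is replaced by the basis vector e_v, that is,
    the (v, v) cofactor.  The theorem is a statement on such cofactors for the
    derived graph, and the Fourier transform of the cyclic group turns them
    into data of the base graph.

    The Laplacian of the derived graph commutes with the translations of the
    fibres.  In the basis of the characters chi_i : x |-> z ^ (i x) of Z/p it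
    becomes block diagonal; the i-th block is the Laplacian of the base graph
    in which every voltage g is weighted by chi_i g.  Block 0 is the ordinary
    Laplacian, whose determinant vanishes, and block i > 0 is the conjugate
    sigma_i of the voltage Laplacian.

    A vanishing determinant carries no information on cofactors, so the
    Laplacian of the derived graph is perturbed by 'X on the diagonal entries
    over v, which adds 'X to the entry (v, v) of each block
    ([fourier_factorization]).  The coefficient of 'X on the left is the sum of
    A over the lifts of v ([coef1_fdet_addX]); all lifts contribute equally,
    since translations are automorphisms of the derived graph.  On the right,
    block 0 is A_v 'X up to higher order, and the other blocks only their
    constant terms.  Hence
      p * A_(lift of v) = A_v * prod_(i > 0) det (sigma_i (lap)),
    which is [derived_arb_sum].

    It remains to see that the determinant of multiplication by f is the
    product of the conjugates of f ([ext_norm_conjugates]): the matrix of the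
    sigma_k (b_i), for b a rational basis, diagonalizes this multiplication
    with eigenvalues sigma_k (f), and a Vandermonde matrix in the powers of zeta
    shows that it is invertible. *)

(** * Determinants indexed by a finite type *)

(** Vertex sets are arbitrary finite types, and the derived graph has vertices in
    a product; the choice of an enumeration is immaterial by [fdetE]. *)
Definition fdet (R : comNzRingType) (T : finType) (A : T -> T -> R) : R :=
  \det (\matrix_(i < #|T|, j < #|T|) A (enum_val i) (enum_val j)).

Section FiniteDeterminant.

Variable R : comNzRingType.
Implicit Types T I J : finType.

Lemma eq_fdet T (A B : T -> T -> R) :
  (forall i j, A i j = B i j) -> fdet A = fdet B.
Proof. by move=> eqAB; congr (\det _); apply/matrixP=> i j; rewrite !mxE. Qed.

(** Two enumerations of T differ by a permutation, which acts on rows and on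
    columns: its sign is squared. *)
Lemma fdetE T (A : T -> T -> R) n (h : 'I_n -> T) :
  bijective h -> fdet A = \det (\matrix_(i, j) A (h i) (h j)).
Proof.
move=> bij_h; have def_n : n = #|T| by rewrite -(bij_eq_card bij_h) card_ord.
subst n.
have inj_s : injective (enum_rank \o h).
  exact: inj_comp enum_rank_inj (bij_inj bij_h).
pose s := perm inj_s.
rewrite /fdet; set M := (X in \det X = _).
have -> : \matrix_(i, j) A (h i) (h j) = row_perm s (col_perm s M).
  by apply/matrixP=> i j; rewrite !mxE !permE /= !enum_rankK.
rewrite row_permE col_permE !det_mulmx !det_perm odd_permV mulrCA -expr2.
by rewrite sqrr_sign mulr1.
Qed.

Lemma fdet_reindex T T' (h : T' -> T) (A : T -> T -> R) :
  bijective h -> fdet (fun i j => A (h i) (h j)) = fdet A.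
Proof.
by move=> bij_h; rewrite [RHS](fdetE A (bij_comp bij_h (enum_val_bij T'))).
Qed.

Lemma fdet_mul T (A B : T -> T -> R) :
  fdet A * fdet B = fdet (fun i j => \sum_k A i k * B k j).
Proof.
rewrite -det_mulmx; congr (\det _); apply/matrixP=> i j; rewrite !mxE.
rewrite (reindex (@enum_val T predT)); last exact: onW_bij (enum_val_bij T).
by apply: eq_bigr => k _; rewrite !mxE.
Qed.

Lemma fdet_scale T (c : T -> R) (A : T -> T -> R) :
  fdet (fun i j => c i * A i j) = \prod_i c i * fdet A.
Proof.
rewrite (reindex (@enum_val T predT)); last exact: onW_bij (enum_val_bij T).
have -> : \prod_(j < #|T|) c (enum_val j) = \det (diag_mx (\row_(j < #|T|) c (enum_val j))).
  by rewrite det_diag; apply: eq_bigr => k _; rewrite mxE.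
rewrite -det_mulmx mul_diag_mx; congr (\det _).
by apply/matrixP=> i j; rewrite !mxE.
Qed.

(** Cramer's rule: a vector u killed by A is killed by the determinant of A.
    This needs no field, so that singularity can be shown over any ring. *)
Lemma fdet_mul_ker T (A : T -> T -> R) (u : T -> R) k :
  (forall i, \sum_j A i j * u j = 0) -> fdet A * u k = 0.
Proof.
move=> Au0; set M := \matrix_(i < #|T|, j < #|T|) A (enum_val i) (enum_val j).
pose U := \col_(j < #|T|) u (enum_val j).
have MU0 : M *m U = 0.
  apply/colP=> i; rewrite !mxE -[RHS](Au0 (enum_val i)).
  rewrite [RHS](reindex (@enum_val T predT)) /=; last exact: onW_bij (enum_val_bij T).
  by apply: eq_bigr => j _; rewrite !mxE.
have /(congr1 (fun X => (\adj M *m X) (enum_rank k) 0)) := MU0.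
rewrite mulmxA mul_adj_mx mul_scalar_mx mulmx0 !mxE.
by rewrite enum_rankK.
Qed.

(** Multilinearity in all rows at once; choosing a summand in each row is
    what turns a determinant into a sum over functional graphs. *)
Lemma fdet_sum T (J : finType) (r : T -> J -> T -> R) :
  fdet (fun i j => \sum_a r i a j)
    = \sum_(f : {ffun T -> J}) fdet (fun i j => r i (f i) j).
Proof.
pose e := fun i : 'I_#|T| => enum_val i : T.
pose phi (g : {ffun 'I_#|T| -> J}) := [ffun i => g (enum_rank i)] : {ffun T -> J}.
have bij_phi : bijective phi.
  exists (fun f : {ffun T -> J} => [ffun i => f (e i)]) => g.
    by apply/ffunP=> i; rewrite !ffunE enum_valK.
  by apply/ffunP=> i; rewrite !ffunE /e enum_rankK.
rewrite [RHS](reindex phi) /=; last exact: onW_bij bij_phi.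
rewrite /fdet /determinant exchange_big /=; apply: eq_bigr => s _.
rewrite -mulr_sumr; congr (_ * _).
transitivity (\prod_i \sum_a r (e i) a (e (s i))).
  by apply: eq_bigr => i _; rewrite mxE.
rewrite bigA_distr_bigA; apply: eq_bigr => g _.
by apply: eq_bigr => i _; rewrite mxE ffunE enum_valK.
Qed.

Lemma det_mxdiag m n (B : 'I_m -> 'M[R]_n) :
  \det (mxdiag B) = \prod_i \det (B i).
Proof.
elim: m B => [|m IHm] B.
  have det_empty k (M : 'M[R]_k) : k = 0%N -> \det M = 1.
    by move=> k0; subst k; rewrite det_mx00.
  by rewrite [RHS]big_ord0 det_empty ?big_ord0.
rewrite [RHS]big_ord_recl -IHm -(det_ublock _ 0) mxdiag_recl.
set N := block_mx _ _ _ _.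
by case: _ / mxsize_recl.
Qed.

Lemma fdet_block T I (B : I -> T -> T -> R) :
  fdet (fun v w : T * I => if v.2 == w.2 then B v.2 v.1 w.1 else 0)
    = \prod_i fdet (B i).
Proof.
pose h (s : 'I_(\sum_(i < #|I|) #|T|)) : T * I :=
  (enum_val (tagnat.sig2 s), enum_val (tagnat.sig1 s)).
have bij_h : bijective h.
  pose k (v : T * I) : 'I_(\sum_(i < #|I|) #|T|) :=
    tagnat.Rank (enum_rank v.2) (enum_rank v.1).
  exists k => [s | [v i]].
    by rewrite /k /h /= !enum_valK -[s in RHS]tagnat.sigK /tagnat.Rank -tagnat.sigE12.
  rewrite /h /k /= tagnat.Rank1K tagnat.Rank2K /= !enum_rankK.
  by congr (_, _); rewrite -[RHS]enum_rankK; congr (enum_val _); apply: val_inj.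
rewrite (fdetE _ bij_h) [RHS](reindex (@enum_val I predT)) /=; last exact: onW_bij (enum_val_bij I).
rewrite -det_mxdiag; congr (\det _); apply/matrixP=> s t; rewrite !mxE /h /=.
rewrite (inj_eq enum_val_inj) conform_mx_id.
by case: eqP => _; rewrite !mxE.
Qed.

Lemma coef1_prod_linear (I : finType) (a b : I -> R) :
  (\prod_i ((a i)%:P + b i *: 'X))`_1 = \sum_i b i * \prod_(j | j != i) a j.
Proof.
suff H (r : seq I) : uniq r ->
    (\prod_(i <- r) ((a i)%:P + b i *: 'X))`_0 = \prod_(i <- r) a i /\
    (\prod_(i <- r) ((a i)%:P + b i *: 'X))`_1
       = \sum_(i <- r) b i * \prod_(j <- r | j != i) a j.
  by have [_ ->] := H _ (index_enum_uniq I).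
elim: r => [_|i r IHr /= /andP[i_r /IHr[IH0 IH1]]].
  by rewrite !big_nil !coef1.
rewrite !big_cons !coefM big_ord_recl big_ord0 addr0 /= IH0; split.
  by rewrite coefD coefC coefZ coefX mulr0 addr0.
rewrite !big_ord_recl big_ord0 addr0 /= IH0 IH1 !coefD !coefC !coefZ !coefX.
rewrite /= mulr0 mulr1 add0r addr0 eqxx /= addrC; congr (b i * _ + _).
  rewrite big_seq [RHS]big_seq_cond; apply: eq_bigl => j.
  by case: eqP => [->|_]; rewrite ?andbT // (negPf i_r).
rewrite mulr_sumr big_seq [RHS]big_seq; apply: eq_bigr => j j_r.
rewrite big_cons; case: eqP => [ij|_]; first by rewrite ij j_r in i_r.
by rewrite mulrCA.
Qed.

(** The derivative at 0 of the determinant along a diagonal direction is a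
    combination of principal cofactors, written as determinants with row k
    replaced by a basis vector. *)
Lemma coef1_fdet_addX T (M : T -> T -> R) (s : T -> R) :
  (fdet (fun i j => (M i j)%:P + (s i *+ (i == j)) *: 'X))`_1
    = \sum_k s k * fdet (fun i j => if i == k then (i == j)%:R else M i j).
Proof.
pose e := fun i : 'I_#|T| => enum_val i : T.
rewrite [RHS](reindex e) /=; last exact: onW_bij (enum_val_bij T).
rewrite /fdet /determinant coef_sum.
under [RHS]eq_bigr => k _ do rewrite mulr_sumr.
rewrite exchange_big /=; apply: eq_bigr => f _.
rewrite -polyC1 -polyCN -polyC_exp coefCM.
under eq_bigr => i _ do rewrite mxE.
rewrite (coef1_prod_linear (fun i => M (e i) (e (f i))) (fun i => s (e i) *+ (e i == e (f i)))).
rewrite mulr_sumr; apply: eq_bigr => k _.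
rewrite [X in _ = s _ * (_ * X)](bigD1 k) //= mxE eqxx.
rewrite -[in RHS]mulrCA; congr (_ * _); rewrite -[s _ *+ _]mulr_natr -mulrA; congr (_ * (_ * _)).
apply: eq_bigr => i ik; rewrite mxE; case: eqP => // /enum_val_inj ei.
by rewrite ei eqxx in ik.
Qed.

End FiniteDeterminant.

Lemma fdet_map (R S : comNzRingType) (f : {rmorphism R -> S}) (T : finType)
  (A : T -> T -> R) : fdet (fun i j => f (A i j)) = f (fdet A).
Proof.
by rewrite -det_map_mx; congr (\det _); apply/matrixP=> i j; rewrite !mxE.
Qed.

(** * The determinant of a functional graph *)

(** The matrix 1 - N, where N is the partial function g seen as a matrix.  If g
    has a height function, then N is nilpotent and 1 - N unipotent.  Otherwise
    some points never leave the domain of g under iteration, and the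
    indicator function of the set of these points lies in the kernel. *)
Lemma fdet_functional (R : comNzRingType) (T : finType) (g : T -> option T) :
  fdet (fun i j => (i == j)%:R - (g i == Some j)%:R : R)
  = `[< exists h : T -> nat, forall i j, g i = Some j -> (h j < h i)%N >]%:R.
Proof.
pose escapes i := `[< exists n, iter n (obind g) (Some i) = None >].
have escapesE i : escapes i = if g i is Some j then escapes j else true.
  apply/asboolP/idP => [[[//|n]]|].
    rewrite iterSr /=; case: (g i) => // j gn; apply/asboolP; by exists n.
  case gi: (g i) => [j|] => [/asboolP[n gn]|_]; last by exists 1%N.
  by exists n.+1; rewrite iterSr /= gi.
(* A point escapes if and only if its image does, so the indicator function of
   the points that do not escape is invariant under g. *)
case: asboolP => [[h h_lt]|no_h]; last first.
  have [k k_stuck] : exists k, ~~ escapes k.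
    apply: contra_notP no_h => no_k.
    have ex_n i : exists n, iter n (obind g) (Some i) == None.
      suff /asboolP[n /eqP gn] : escapes i by exists n.
      by apply/negPn/negP => esc_i; apply: no_k; exists i.
    exists (fun i => ex_minn (ex_n i)) => i j gi.
    case: ex_minnP => m _ m_min; case: ex_minnP => [[|n]] //.
    rewrite iterSr /= gi => n_esc _; rewrite ltnS; exact: m_min.
  set A := (X in fdet X); suff : fdet A * (~~ escapes k)%:R = 0.
    by rewrite k_stuck mulr1.
  apply: (fdet_mul_ker (u := fun i => (~~ escapes i)%:R)) => i; rewrite /A.
  under eq_bigr => j _ do rewrite mulrBl.
  rewrite sumrB (bigD1 i) //= eqxx mulr1n mul1r big1 => [|j /negPf]; last first.
    by rewrite eq_sym => ->; rewrite mul0r.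
  rewrite addr0 escapesE; case gi: (g i) => [j|] /=.
    rewrite (bigD1 j) //= eqxx mulr1n mul1r big1 ?addr0 ?subrr // => l /negPf.
    by rewrite eq_sym (inj_eq Some_inj) => ->; rewrite mul0r.
  by rewrite big1 ?subrr // => l _; rewrite mul0r.
pose e := fun i : 'I_#|T| => enum_val i : T.
rewrite /fdet /determinant (bigD1 1%g) //= [X in _ + X]big1 => [|s s_neq1].
  rewrite addr0 odd_perm1 mul1r big1 // => i _; rewrite mxE perm1 eqxx.
  by case: eqP => [/h_lt|]; rewrite ?ltnn ?subr0.
have [/existsP[i /eqP Mi0]|/existsPn Mn0] :=
    boolP [exists i, ((e i == e (s i))%:R - (g (e i) == Some (e (s i)))%:R == 0 :> R)].
  by rewrite (bigD1 i) //= mxE Mi0 mul0r mulr0.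
case/eqP: s_neq1; apply/permP=> i; rewrite perm1.
(* A permutation with a nonzero term never increases the height, and it
   preserves the sum of the heights; so it fixes every point. *)
have h_leif k : true -> (h (e (s k)) <= h (e k) ?= iff (s k == k))%N.
  move=> _; apply/leqifP; case: eqVneq => [->//|sk_neq].
  apply: h_lt; apply/eqP; move: (Mn0 k); apply: contraNT => /negPf->.
  by rewrite (inj_eq enum_val_inj) [k == _]eq_sym (negPf sk_neq) subrr.
have [_ /esym] := leqif_sum h_leif.
rewrite [X in _ == X](reindex_inj (@perm_inj _ s)) eqxx => /forallP/(_ i)/eqP.
by [].
Qed.

(** * The matrix-tree theorem *)

Section Arborescences.

Variable D : digraph.
Implicit Types (T : {set edge D}) (v w x y : vertex D) (e : edge D).

(** The local form of an arborescence, as the graph of a partial function of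
    domain the vertices other than v that decreases a height h. *)
Definition functional_tree v T : Prop :=
  [/\ forall e, e \in T -> source e != v,
      {in T &, injective (@source D)},
      forall w, w != v -> exists2 e, e \in T & source e = w
    & exists h : vertex D -> nat, forall e, e \in T -> (h (target e) < h (source e))%N].

Lemma upath_cat T x y z s1 s2 :
  upath T x s1 y -> upath T y s2 z -> upath T x (s1 ++ s2) z.
Proof.
elim: s1 x => [|d s1 IHs] x /=; first by move=> /eqP->.
by case/and3P=> -> -> s1P s2P; apply: IHs.
Qed.

Lemma upath_rev T x y s : upath T x s y ->
  upath T y (rev [seq (d.1, ~~ d.2) | d <- s]) x.
Proof.
elim: s x => [|[e b] s IHs] x /=; first by rewrite eq_sym.
case/and3P=> Te /eqP <- /IHs; rewrite rev_cons -cats1 => sP.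
apply: upath_cat sP _ => /=; rewrite Te /dart_source /dart_target /=.
by case: b; rewrite !eqxx.
Qed.

Lemma dipath_upath T x y s : dipath T x s y -> upath T x [seq (e, true) | e <- s] y.
Proof.
by elim: s x => //= e s IHs x /and3P[-> /eqP <- /IHs]; rewrite eqxx.
Qed.

Lemma upath_pred T x y s d : upath T x s y -> d \in s ->
  dart_source d = x \/ exists2 d', d' \in s & dart_target d' = dart_source d.
Proof.
elim: s x => //= d0 s IHs x /and3P[_ /eqP d0x sP]; rewrite inE.
case/predU1P=> [->|ds]; first by left.
right; have [->|[d' d's d'd]] := IHs _ sP ds; first by exists d0; rewrite ?mem_head.
by exists d'; rewrite // inE d's orbT.
Qed.

Lemma upath_succ T x y s d : upath T x s y -> d \in s ->
  dart_target d = y \/ exists2 d', d' \in s & dart_source d' = dart_target d.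
Proof.
elim: s x => //= d0 s IHs x /and3P[_ _ sP]; rewrite inE => /predU1P[->|ds].
  case: s sP {IHs} => [/eqP->|d1 s /= /and3P[_ /eqP d1P _]]; first by left.
  by right; exists d1; rewrite // !inE eqxx orbT.
have [->|[d' d's d'd]] := IHs _ sP ds; first by left.
by right; exists d'; rewrite // inE d's orbT.
Qed.

Lemma upath_mem T x y s d : upath T x s y -> d \in s -> d.1 \in T.
Proof.
elim: s x => //= d0 s IHs x /and3P[Td0 _ sP]; rewrite inE.
by case/predU1P=> [->//|]; apply: IHs sP.
Qed.

Lemma upath_last T x y s : upath T x s y -> s != [::] ->
  exists2 d, d \in s & dart_target d = y.
Proof.
elim: s x => //= d s IHs x /and3P[_ _ sP] _.
case: s sP IHs => [/eqP dy _|d1 s sP /(_ _ sP isT)[d' d's d'y]].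
  by exists d; rewrite ?mem_head.
by exists d'; rewrite // inE d's orbT.
Qed.

(** Consider the edge of a cycle whose source is highest.  The other edge of the
    cycle at this source cannot enter it, since it would come from higher up;
    so it leaves it too, and the two edges are the same. *)
Lemma functional_tree_acyclic v T s : functional_tree v T -> ~ ucycle_in T s.
Proof.
move=> [_ inj_src _ [h h_lt]] [s_neq0 uniq_s _ [x sP]].
have mem_eq d d' : d \in s -> d' \in s -> d.1 = d'.1 -> d = d'.
  move=> ds d's dd'; rewrite -(nth_index d ds) -(nth_index d d's); congr nth.
  apply/eqP; rewrite -(nth_uniq d.1 _ _ uniq_s) ?size_map ?index_mem //.
  by rewrite !(nth_map d) ?index_mem // !nth_index // dd'.
have sT d : d \in s -> d.1 \in T by apply: upath_mem sP.
have [d0 d0s] : exists d, d \in s by case: (s) s_neq0 => // d ? _; exists d; rewrite mem_head.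
case: (@arg_maxnP (edge D) d0.1 [pred e | e \in map fst s] (fun e => h (source e))).
  by apply/mapP; exists d0.
move=> e /mapP[d ds ->] {d0 d0s e} d_max.
have {}d_max d' : d' \in s -> (h (source d'.1) <= h (source d.1))%N.
  by move=> d's; apply: d_max; apply/mapP; exists d'.
(* A dart of the opposite direction at the highest source would be carried by
   the edge of d, which the cycle traverses only once. *)
have clash (d' : edge D * bool) : d' \in s -> d'.2 = ~~ d.2 ->
    source d'.1 = source d.1 -> False.
  move=> d's d'2 d'1; move: (d'2); rewrite (mem_eq d' d) //; first by case: (d.2).
  by apply: inj_src; rewrite ?sT.
case: d ds d_max clash => e [] ds d_max clash.
  have [d' d's] : exists2 d', d' \in s & dart_target d' = source e.
    rewrite -[source e]/(dart_source (e, true)).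
    by have [->|//] := upath_pred sP ds; apply: upath_last sP s_neq0.
  case: d' d's => e' [] e's; rewrite /dart_target /= => e'e; last exact: clash e's _ _.
  by have := h_lt _ (sT _ e's); rewrite /= e'e ltnNge (d_max _ e's).
have [d' d's] : exists2 d', d' \in s & dart_source d' = source e.
  rewrite -[source e]/(dart_target (e, false)).
  have [->|//] := upath_succ sP ds.
  case: (s) sP s_neq0 => //= d1 s1 /and3P[_ /eqP <- _] _.
  by exists d1; rewrite ?mem_head.
case: d' d's => e' [] e's; rewrite /dart_source /= => e'e; first exact: clash e's _ _.
by have := h_lt _ (sT _ e's); rewrite /= e'e ltnNge (d_max _ e's).
Qed.

(** The height of w is the length of its path to v.  Conversely, following the
    unique edge out of each vertex decreases the height, hence ends at v. *)
Lemma arborescenceP v T : arborescence v T <-> functional_tree v T.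
Proof.
split=> [[_ path_v]|treeT].
  pose s w := projT1 (cid (path_v w)).
  have sP w : dipath T w (s w) v by rewrite /s; case: cid => ? [].
  have s_uniq w t : dipath T w t v -> s w = t by rewrite /s; case: cid => ? [? +]; apply.
  have s_edge e : e \in T -> s (source e) = e :: s (target e).
    by move=> Te; apply: s_uniq; rewrite /= Te eqxx sP.
  split.
  - move=> e Te; apply/eqP=> ev; have := s_edge e Te.
    by rewrite ev (s_uniq v [::]) /=.
  - by move=> e e' /s_edge De /s_edge De' ee'; move: De; rewrite ee' De' => -[].
  - move=> w w_v; move: (sP w); case: (s w) => [/eqP wv|e t]; first by rewrite wv eqxx in w_v.
    by case/and3P=> Te /eqP <- _; exists e.
  - by exists (size \o s) => e Te; rewrite /= s_edge.
have [no_v inj_src has_out [h h_lt]] := treeT.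
have path_v w : exists t, dipath T w t v.
  have [n] := ubnP (h w); elim: n w => // n IHn w hw.
  have [->|w_v] := eqVneq w v; first by exists [::] => /=.
  have [e Te ew] := has_out w w_v.
  have [|t tP] := IHn (target e); first by rewrite (leq_trans (h_lt e Te)) // ew.
  by exists (e :: t); rewrite /= Te ew eqxx.
split; last first.
  move=> w; have [t tP] := path_v w; exists t; split=> // t'.
  elim: t w tP t' => [|e t IHt] w /=.
    move=> /eqP-> [|e t] //= /and3P[Te /eqP ev _].
    by have := no_v e Te; rewrite ev eqxx.
  case/and3P=> Te /eqP ew tP [|e' t'] /=.
    by move=> /eqP wv; have := no_v e Te; rewrite ew wv eqxx.
  case/and3P=> Te' /eqP ew'; have <- : e = e' by apply: inj_src; rewrite ?ew.
  by move=> /(IHt _ tP)->.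
split; last by move=> [s]; apply: functional_tree_acyclic treeT.
move=> x y; have [[t tP] [t' t'P]] := (path_v x, path_v y).
by exists ([seq (e, true) | e <- t] ++ rev [seq (d.1, ~~ d.2) | d <- [seq (e, true) | e <- t']]);
  apply: upath_cat (dipath_upath tP) _; apply: upath_rev; apply: dipath_upath.
Qed.

Variables (R : comNzRingType) (wt : edge D -> R).

Definition laplacian x y : R :=
  (\sum_(e | source e == x) wt e) *+ (x == y)
  - \sum_(e | (source e == x) && (target e == y)) wt e.

Lemma laplacianE x y :
  laplacian x y = \sum_(e | source e == x) wt e * ((x == y)%:R - (target e == y)%:R).
Proof.
under eq_bigr => e _ do rewrite mulrBr.
rewrite sumrB -mulr_suml mulr_natr; congr (_ - _).
rewrite big_mkcondr; apply: eq_bigr => e _.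
by case: (target e == y); rewrite ?mulr1 ?mulr0.
Qed.

Lemma laplacian_mul (u : vertex D -> R) x :
  \sum_y laplacian x y * u y = \sum_(e | source e == x) wt e * (u x - u (target e)).
Proof.
have pick_one z : \sum_y (z == y)%:R * u y = u z.
  rewrite (bigD1 z) //= eqxx mul1r big1 ?addr0 // => y /negPf.
  by rewrite eq_sym => ->; rewrite mul0r.
under eq_bigr => y _ do rewrite laplacianE mulr_suml.
rewrite exchange_big /=; apply: eq_bigr => e _.
under eq_bigr => y _ do rewrite -mulrA mulrBl.
by rewrite -mulr_sumr sumrB !pick_one.
Qed.

(** Arborescences rooted at v are encoded as functions f choosing an edge out
    of every vertex but v, since multilinearity yields sums over functions. *)
Definition out_choice v (f : {ffun vertex D -> option (edge D)}) : bool :=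
  [forall w, if f w is Some e then (w != v) && (source e == w) else w == v].

Lemma out_choice_None v f : out_choice v f -> f v = None.
Proof. by move/forallP/(_ v); case: (f v) => // e; rewrite eqxx. Qed.

Definition chosen (f : {ffun vertex D -> option (edge D)}) : {set edge D} :=
  [set e | f (source e) == Some e].

Definition choice_in v T : {ffun vertex D -> option (edge D)} :=
  [ffun w => if w == v then None else [pick e in T | source e == w]].

Lemma chosenK v f : out_choice v f -> choice_in v (chosen f) = f.
Proof.
move=> f_ok; apply/ffunP=> w; rewrite ffunE.
have [->|w_v] := eqVneq w v; first by rewrite (out_choice_None f_ok).
have := forallP f_ok w; case Df: (f w) => [e|]; last by rewrite (negPf w_v).
case/andP=> _ /eqP ew; case: pickP => [e' | /(_ e)].
  by rewrite inE => /andP[/eqP De' /eqP e'w]; rewrite -De' e'w.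
by rewrite /= inE ew Df !eqxx.
Qed.

Lemma choice_inE v T w e : functional_tree v T ->
  (choice_in v T w == Some e) = (e \in T) && (source e == w).
Proof.
case=> no_v inj_src has_out _; rewrite ffunE.
have [->|w_v] := eqVneq w v.
  by symmetry; apply/negP=> /andP[/no_v/negP].
case: pickP => [e' /andP[Te' /eqP e'w]|none].
  rewrite (inj_eq Some_inj); apply/eqP/andP=> [<-|[Te /eqP ew]]; first by rewrite Te' e'w.
  by apply: inj_src; rewrite ?ew.
by have := none e; rewrite /= => ->.
Qed.

Lemma arborescence_choice v T :
  `[< arborescence v T >] =
  [&& out_choice v (choice_in v T), chosen (choice_in v T) == T
    & `[< exists h : vertex D -> nat, forall x y,
            omap (@target D) (choice_in v T x) = Some y -> (h y < h x)%N >]].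
Proof.
apply/asboolP/and3P=> [/arborescenceP treeT | [ok /eqP DT /asboolP[h h_lt]]].
  have [no_v inj_src has_out [h h_lt]] := treeT.
  split.
  - apply/forallP=> w; case Df: (choice_in v T w) => [e|].
      move/eqP: Df; rewrite choice_inE // => /andP[Te /eqP <-].
      by rewrite no_v //=.
    apply: contraT => w_v; have [e Te ew] := has_out w w_v.
    suff : choice_in v T w == Some e by rewrite Df.
    by rewrite choice_inE // Te ew /=.
  - by apply/eqP/setP=> e; rewrite inE choice_inE // eqxx andbT.
  - apply/asboolP; exists h => x y; case Df: (choice_in v T x) => [e|] //= [<-].
    by move/eqP: Df; rewrite choice_inE // => /andP[/h_lt + /eqP <-].
have mem e : e \in T -> choice_in v T (source e) = Some e.
  by rewrite -{1}DT inE => /eqP.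
apply/arborescenceP; split.
- by move=> e /mem De; have := forallP ok (source e); rewrite De => /andP[].
- by move=> e e' /mem De /mem De' ee'; move: De; rewrite ee' De' => -[].
- move=> w w_v; have := forallP ok w; case De: (choice_in v T w) => [e|].
    by case/andP=> _ /eqP ew; exists e; rewrite // -DT inE ew De.
  by rewrite (negPf w_v).
- by exists h => e /mem De; apply: h_lt; rewrite De.
Qed.

(** Row w of the matrix is the sum, over the edges e out of w, of
    wt e times the row e_w - e_(target e).  Expanding all rows gives a sum over the
    choices of one edge out of each w other than v, where the determinant left
    is that of a functional graph: 1 for an arborescence and 0 otherwise. *)
Theorem matrix_tree v :
  arb_sum wt v = fdet (fun x y => if x == v then (x == y)%:R else laplacian x y).
Proof.
pose c x (a : option (edge D)) : R :=
  if a is Some e then if (x != v) && (source e == x) then wt e else 0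
  else (x == v)%:R.
pose r x (a : option (edge D)) y : R := (x == y)%:R - (omap (@target D) a == Some y)%:R.
have big_option (F : option (edge D) -> R) : \sum_a F a = F None + \sum_e F (Some e).
  rewrite (bigD1 None) //=; congr (_ + _).
  rewrite (reindex_omap Some id) //=; last by case.
  by apply: eq_bigl => e; rewrite eqxx.
transitivity (fdet (fun x y => \sum_a c x a * r x a y)); last first.
  apply: eq_fdet => x y; rewrite big_option /c /r /=.
  have [->|x_v] := eqVneq x v.
    by rewrite mul1r subr0 big1 ?addr0 // => e _; rewrite mul0r.
  rewrite mul0r add0r laplacianE [RHS]big_mkcond; apply: eq_bigr => e _.
  by case: (source e == x); rewrite ?mul0r // (inj_eq Some_inj).
(* The choice None stands for the row e_v, and [c] vanishes on the choices
   that are not allowed. *)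
rewrite fdet_sum.
under [RHS]eq_bigr => f _ do rewrite
  (fdet_scale (fun x => c x (f x)) (fun x y => r x (f x) y)) fdet_functional.
rewrite [RHS](bigID (out_choice v)) /= [X in _ = _ + X]big1 ?addr0; last first.
  move=> f /forallPn[w not_ok]; rewrite (bigD1 w) //= /c.
  by case: (f w) not_ok => [e|] /negPf->; rewrite !mul0r.
rewrite (reindex_onto (choice_in v) chosen) /=; last exact: chosenK.
rewrite /arb_sum big_mkcond [RHS]big_mkcond /=; apply: eq_bigr => T _.
rewrite arborescence_choice; case: ifP => [/and3P[ok /eqP DT ->]|]; last first.
  by case: (out_choice _ _) => //=; case: (_ == T) => //= ->; rewrite mulr0.
rewrite ok DT eqxx mulr1 -[in LHS]DT.
rewrite (partition_big (@source D) xpredT) //=; apply: eq_bigr => w _.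
have := forallP ok w; rewrite /c; case Dw: (choice_in v T w) => [e|].
  case/andP=> w_v ew; rewrite w_v ew /=; apply: big_pred1 => e'.
  rewrite inE /=; apply/andP/eqP => [[/eqP De' /eqP e'w]|->].
    by move: Dw; rewrite -e'w De' => -[].
  by rewrite (eqP ew) Dw.
move=> ->; apply: big_pred0 => e; rewrite inE; apply/negP => /andP[+ /eqP ew].
by rewrite ew Dw.
Qed.

End Arborescences.

Lemma arb_sum_map (D : digraph) (R S : comNzRingType) (f : {rmorphism R -> S})
  (wt : edge D -> R) v : arb_sum (fun e => f (wt e)) v = f (arb_sum wt v).
Proof. by rewrite rmorph_sum; apply: eq_bigr => T _; rewrite rmorph_prod. Qed.

(** * Derived graphs and the Fourier transform *)

Section DerivedGraph.

Variables (G : finGroupType) (Gamma : voltage_graph G).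
Variables (R : comNzRingType) (wt : edge Gamma -> R).

Lemma sum_derived_edges (F : edge Gamma * G -> R) v x :
  \sum_(e : edge (derived_graph Gamma) | source e == (v, x)) F e
    = \sum_(e | source e == v) F (e, x).
Proof.
transitivity (\sum_(e | source e == v) \sum_(y | y == x) F (e, y)).
  by rewrite pair_big_dep; apply: eq_big => -[e y].
by apply: eq_bigr => e _; rewrite big_pred1_eq.
Qed.

(** Right translation by x^-1 y is an automorphism of the derived graph, since
    voltages act on the left. *)
Lemma derived_arb_sum_lift v x y :
  arb_sum (derived_wt wt) ((v, x) : vertex (derived_graph Gamma))
  = arb_sum (derived_wt wt) ((v, y) : vertex (derived_graph Gamma)).
Proof.
rewrite !matrix_tree; pose h (a : vertex Gamma * G) := (a.1, a.2 * (x^-1 * y))%g.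
have bij_h : bijective h.
  exists (fun a => (a.1, a.2 * (x^-1 * y)^-1)%g) => -[w z].
    by rewrite /h /= mulgK.
  by rewrite /h /= mulgKV.
rewrite -[RHS](fdet_reindex _ bij_h); apply: eq_fdet => -[v1 x1] [v2 x2] /=.
rewrite !(inj_eq (bij_inj bij_h)).
have -> : ((v, y) : vertex Gamma * G) = h (v, x) by rewrite /h /= mulKVg.
rewrite !(inj_eq (bij_inj bij_h)); case: ifP => // _.
rewrite !laplacianE /h /= !sum_derived_edges; apply: eq_bigr => e _.
have eqM c d : (c * (x^-1 * y) == d * (x^-1 * y))%g = (c == d).
  exact: inj_eq (mulIg _) _ _.
by rewrite !xpair_eqE /= [(voltage e * (_ * _))%g]mulgA !eqM.
Qed.

End DerivedGraph.

Lemma det_Vandermonde_neq0 (R : idomainType) n (a : 'rV[R]_n) :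
  injective (a 0) -> \det (Vandermonde n a) != 0.
Proof.
move=> inj_a; rewrite det_Vandermonde.
rewrite prodf_seq_neq0; apply/allP=> i _ /=.
rewrite prodf_seq_neq0; apply/allP=> j _ /=; apply/implyP=> ij.
by rewrite subr_eq0 (inj_eq inj_a) -val_eqE /= neq_ltn ij orbT.
Qed.

Section Fourier.

Variables (p : nat) (Gamma : voltage_graph 'Z_p).

(** The Laplacian in which the voltage of an edge acts through chi.  Degree and
    adjacency terms are grouped edge by edge, to be compared with a sum over the
    edges out of a lift of v. *)
Definition twisted_laplacian (R : comNzRingType) (wt : edge Gamma -> R)
    (chi : 'Z_p -> R) v w : R :=
  \sum_(e | source e == v)
     wt e * ((v == w)%:R - (target e == w)%:R * chi (voltage e)).

Lemma twisted_laplacian_map (R S : comNzRingType) (f : {rmorphism R -> S}) wt chi v w :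
  f (twisted_laplacian wt chi v w) =
    twisted_laplacian (fun e => f (wt e)) (fun g => f (chi g)) v w.
Proof.
rewrite rmorph_sum; apply: eq_bigr => e _.
by rewrite rmorphM rmorphB rmorphM !rmorph_nat.
Qed.

Variables (R : idomainType) (z : R).
Hypothesis z_prim : (Zp_trunc p).+2.-primitive_root z.

Definition chi (i g : 'Z_p) : R := z ^+ (i * g)%N.

Lemma chiM i g h : chi i (g * h)%g = chi i g * chi i h.
Proof.
rewrite /chi !exprM -exprD; set y := z ^+ i.
have y_order : y ^+ (Zp_trunc p).+2 = 1.
  by rewrite -exprM mulnC exprM (prim_expr_order z_prim) expr1n.
exact: (expr_mod _ y_order).
Qed.

(** Let Phi be the matrix with columns the functions supported on one fibre,
    where they are a character.  It intertwines the perturbed Laplacian of the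
    derived graph with the block diagonal matrix of its twists.  It is invertible
    because it consists of one Vandermonde matrix for each fibre. *)
Lemma fourier_factorization (wt : edge Gamma -> R) (t : vertex Gamma -> R) :
  fdet (fun a b : vertex (derived_graph Gamma) =>
          laplacian (derived_wt wt) a b + t a.1 *+ (a == b))
  = \prod_(i : 'Z_p)
      fdet (fun v w => twisted_laplacian wt (chi i) v w + t v *+ (v == w)).
Proof.
pose Phi (a b : vertex Gamma * 'Z_p) : R := if a.1 == b.1 then chi b.2 a.2 else 0.
pose B i v w := twisted_laplacian wt (chi i) v w + t v *+ (v == w).
have Phi_neq0 : fdet Phi != 0.
  pose swap (a : 'Z_p * vertex Gamma) := (a.2, a.1).
  have bij_swap : bijective swap by exists (fun a => (a.2, a.1)) => -[].
  rewrite -(fdet_reindex _ bij_swap).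
  rewrite (fdet_block (fun _ (x i : 'Z_p) => chi i x)) prodf_seq_neq0.
  apply/allP=> v _ /=.
  rewrite (fdetE _ (h := (id : 'I_(Zp_trunc p).+2 -> 'Z_p))); last by exists id.
  rewrite (_ : \matrix_(_, _) _ = Vandermonde _ (\row_(i < (Zp_trunc p).+2) z ^+ i)).
    apply: det_Vandermonde_neq0 => i j; rewrite !mxE => /eqP.
    by rewrite (eq_prim_root_expr z_prim) !modn_small // => /eqP/val_inj.
  by apply/matrixP=> x i; rewrite !mxE /chi exprM.
apply: (mulIf Phi_neq0); rewrite -(fdet_block B) [RHS]mulrC !fdet_mul.
apply: eq_fdet => -[v x] [w i].
have tPhi : \sum_k t v *+ ((v, x) == k) * Phi k (w, i) = t v * Phi (v, x) (w, i).
  rewrite (bigD1 (v, x)) //= eqxx big1 ?addr0 // => k /negPf.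
  by rewrite eq_sym => ->; rewrite mul0r.
under eq_bigr => k _ do rewrite mulrDl.
rewrite big_split /= tPhi.
have -> := laplacian_mul (D := derived_graph Gamma) (derived_wt wt) (Phi^~ (w, i)) (v, x).
rewrite sum_derived_edges.
rewrite [RHS](bigD1 (v, i)) //= [X in _ = _ + X]big1 => [|[u j] /=]; last first.
  rewrite /Phi xpair_eqE /= [v == u]eq_sym.
  by case: (u == v); case: (j == i); rewrite ?mul0r ?mulr0.
rewrite addr0 /Phi /= !eqxx /B mulrDr mulr_sumr; congr (_ + _).
  apply: eq_bigr => e _; rewrite chiM mulrCA; congr (_ * _).
  rewrite mulrBr; congr (_ - _); first by case: eqP; rewrite ?mulr1 ?mulr0.
  by case: eqP; rewrite ?mul0r ?mulr0 // mul1r mulrC.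
by case: eqP; rewrite ?mulr0 // mulrC.
Qed.

End Fourier.

Lemma trivial_twist (p : nat) (Gamma : voltage_graph 'Z_p) (R : comNzRingType)
    (wt : edge Gamma -> R) v w :
  twisted_laplacian wt (fun=> 1) v w = laplacian wt v w.
Proof. by rewrite laplacianE; apply: eq_bigr => e _; rewrite mulr1. Qed.

(** Constant functions are in the kernel.  The vertex v excludes the empty
    graph, of determinant 1. *)
Lemma fdet_laplacian (D : digraph) (R : comNzRingType) (wt : edge D -> R) (v : vertex D) :
  fdet (laplacian wt) = 0.
Proof.
rewrite -[LHS]mulr1; apply: (fdet_mul_ker (u := fun=> 1)) v _ => x.
rewrite laplacian_mul big1 // => e _; by rewrite subrr mulr0.
Qed.

Lemma rmorph_prim_root (R S : nzRingType) (f : {rmorphism R -> S}) n z :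
  injective f -> n.-primitive_root z -> n.-primitive_root (f z).
Proof.
move=> inj_f /andP[n_gt0 /forallP z_prim]; apply/andP; split=> //.
apply/forallP=> i; rewrite unity_rootE -rmorphXn -(rmorph1 f) (inj_eq inj_f).
by rewrite -unity_rootE.
Qed.

(** The coefficients of 'X in [fourier_factorization], for the perturbation by
    'X at v. *)
Theorem derived_arb_sum (p : nat) (Gamma : voltage_graph 'Z_p) (R : idomainType) (z : R)
    (wt : edge Gamma -> R) v x :
  (Zp_trunc p).+2.-primitive_root z ->
  arb_sum (derived_wt wt) ((v, x) : vertex (derived_graph Gamma)) *+ #|'Z_p|
  = arb_sum wt v * \prod_(i : 'Z_p | i != 0) fdet (twisted_laplacian wt (chi z i)).
Proof.
move=> z_prim; pose wtX e := (wt e)%:P.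
have zX_prim : (Zp_trunc p).+2.-primitive_root (z%:P).
  exact: (rmorph_prim_root (f := polyC) (@polyC_inj R) z_prim).
pose t (w : vertex Gamma) : {poly R} := (w == v)%:R *: 'X.
have := fourier_factorization zX_prim wtX t.
have -> : fdet (fun a b : vertex (derived_graph Gamma) =>
    laplacian (derived_wt wtX) a b + t a.1 *+ (a == b))
  = fdet (fun a b : vertex (derived_graph Gamma) =>
    (laplacian (derived_wt wt) a b)%:P + ((a.1 == v)%:R *+ (a == b)) *: 'X).
  apply: eq_fdet => a b; rewrite scalerMnl; congr (_ + _).
  rewrite !laplacianE rmorph_sum; apply: eq_bigr => e _.
  by rewrite rmorphM rmorphB !rmorph_nat.
have twistX i : fdet (fun u w => twisted_laplacian wtX (chi z%:P i) u w + t u *+ (u == w))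
  = fdet (fun u w => (twisted_laplacian wt (chi z i) u w)%:P + ((u == v)%:R *+ (u == w)) *: 'X).
  apply: eq_fdet => a b; rewrite scalerMnl; congr (_ + _).
  rewrite twisted_laplacian_map; apply: eq_bigr => e _.
  by rewrite /chi rmorphXn.
under eq_bigr => i _ do rewrite twistX.
move=> /(congr1 (fun q : {poly R} => q`_1)); rewrite coef1_fdet_addX.
have coef0_twist i : (fdet (fun u w => (twisted_laplacian wt (chi z i) u w)%:P
    + ((u == v)%:R *+ (u == w)) *: 'X))`_0 = fdet (twisted_laplacian wt (chi z i)).
  rewrite -[LHS]/(coefp 0 _) -fdet_map; apply: eq_fdet => u w.
  by rewrite /= coefD coefC coefZ coefX mulr0 addr0.
have chi0 : twisted_laplacian wt (chi z 0) =2 laplacian wt.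
  move=> u w; rewrite -trivial_twist; apply: eq_bigr => e _.
  by rewrite /chi mul0n expr0.
have sum_fibre (F : vertex Gamma * 'Z_p -> R) :
    \sum_k (k.1 == v)%:R * F k = \sum_y F (v, y).
  transitivity (\sum_u \sum_y (u == v)%:R * F (u, y)).
    by rewrite pair_big; apply: eq_bigr => -[].
  rewrite (bigD1 v) //= [X in _ + X]big1 ?addr0 => [|u /negPf->].
    by apply: eq_bigr => y _; rewrite eqxx mul1r.
  by rewrite big1 // => y _; rewrite mul0r.
rewrite (eq_bigr (fun k : vertex (derived_graph Gamma) =>
  (k.1 == v)%:R * arb_sum (derived_wt wt) k)) => [|k _]; last by rewrite matrix_tree.
rewrite sum_fibre.
rewrite (eq_bigr (fun=> arb_sum (derived_wt wt) ((v, x) : vertex (derived_graph Gamma))))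
  => [|y _]; last exact: derived_arb_sum_lift.
rewrite sumr_const => ->.
rewrite (bigD1 0) //= coefM !big_ord_recl big_ord0 addr0 /= coef0_twist.
rewrite (eq_fdet chi0) (fdet_laplacian _ v) mul0r add0r subnn.
rewrite coef1_fdet_addX (bigD1 v) //= [X in _ + X]big1 ?addr0 => [|u /negPf->]; last first.
  by rewrite mul0r.
rewrite eqxx mul1r matrix_tree; congr (_ * _).
  by apply: eq_fdet => u w; rewrite chi0.
rewrite -[LHS]/(coefp 0 _) rmorph_prod; apply: eq_bigr => i _.
exact: coef0_twist.
Qed.

(** * Norms from the cyclotomic field and the conclusion *)

Section Norm.

Variables (p : nat) (L : fieldExtType rat) (zeta : L).
Hypotheses (p_prime : prime p) (zeta_prim : p.-primitive_root zeta).
Hypothesis zeta_gen : <<1; zeta>>%VS = {:L}%VS.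

(** The minimal polynomial of zeta divides the cyclotomic polynomial, of degree
    p - 1, and has the p - 1 roots zeta ^ i. *)
Lemma dim_cyclotomic : \dim {:L} = p.-1.
Proof.
have size_min : size (minPoly 1 zeta) = (\dim {:L}).+1.
  by rewrite size_minPoly adjoin_degreeE zeta_gen dimv1 divn1.
apply/eqP; rewrite -eqSS -size_min (prednK (prime_gt0 p_prime)) eqn_leq.
apply/andP; split.
  have size_Phi : size (map_poly intr 'Phi_p : {poly L}) = p.
    rewrite size_map_poly_id0; last by rewrite (monicP (Cyclotomic_monic p)) oner_eq0.
    by rewrite size_Cyclotomic totient_prime // (prednK (prime_gt0 p_prime)).
  rewrite -size_Phi; apply: dvdp_leq.
    by rewrite -size_poly_gt0 size_Phi prime_gt0.
  apply: minPoly_dvdp; last exact: root_Cyclotomic_prime.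
  apply/polyOver1P; exists (map_poly intr 'Phi_p).
  by rewrite -map_poly_comp; apply: eq_map_poly => m /=; rewrite scaler_int.
have := @max_poly_roots _ (minPoly 1 zeta) [seq zeta ^+ i | i <- iota 1 p.-1].
rewrite size_map size_iota => card_roots.
rewrite -[X in (X <= _)%N](prednK (prime_gt0 p_prime)); apply: card_roots.
- exact: monic_neq0 (monic_minPoly _ _).
- apply/allP=> _ /mapP[i + ->]; rewrite mem_iota add1n (prednK (prime_gt0 p_prime)).
  case/andP=> i_gt0 i_lt_p.
  apply: root_minPoly_prim_root p_prime zeta_prim _.
  by rewrite prim_root_exp_coprime // coprime_sym prime_coprime // gtnNdvd.
rewrite map_inj_in_uniq ?iota_uniq // => i j.
rewrite !mem_iota !add1n (prednK (prime_gt0 p_prime)) => /andP[_ i_lt] /andP[_ j_lt] /eqP.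
by rewrite (eq_prim_root_expr zeta_prim) !modn_small // => /eqP.
Qed.

(** With b a rational basis, N the matrix of multiplication by f in it and
    E = (sigma_k (b_i)), one has N E = E diag (sigma_k (f)): sigma_k fixes the
    rational coordinates of f * b_i, and so maps f * b_i to the combination of
    the sigma_k (b_j) with the same coordinates. *)
Lemma ext_norm_conjugates n (f : {mpoly L[n]}) :
  map_mpoly (in_alg L) (ext_norm f)
    = \prod_(1 <= i < p) map_mpoly (cycl_aut zeta i) f.
Proof.
set d := \dim {:L}; have dP : d = p.-1 := dim_cyclotomic.
pose b := vbasis {:L}; pose sigma (k : 'I_d) := cycl_aut zeta k.+1.
have sigma_zeta k : sigma k zeta = zeta ^+ k.+1.
  rewrite (cycl_autE p_prime) //= -[p](prednK (prime_gt0 p_prime)) ltnS -dP; exact: ltn_ord.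
pose N : 'M[{mpoly L[n]}]_d := map_mx (map_mpoly (in_alg L))
   (\matrix_(i < d, j < d) map_mpoly (coord b j) (f * (b`_i)%:MP)).
pose E : 'M[L]_d := \matrix_(i, k) sigma k b`_i.
have E_neq0 : \det E != 0.
  (* The coordinates C of the powers of zeta satisfy C E = Vandermonde, whether
     or not these powers form a basis. *)
  pose C : 'M[L]_d := \matrix_(m, j) (coord b j (zeta ^+ m))%:A.
  have CE : C *m E = Vandermonde d (\row_(k < d) zeta ^+ k.+1).
    apply/matrixP=> m k; rewrite !mxE -sigma_zeta -rmorphXn /=.
    rewrite [in RHS](coord_vbasis (memvf (zeta ^+ m))) linear_sum.
    by apply: eq_bigr => j _; rewrite !mxE linearZ /= mulr_algl.
  have : \det (Vandermonde d (\row_(k < d) zeta ^+ k.+1)) != 0.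
    apply: det_Vandermonde_neq0 => i j.
    have lt_p (k : 'I_d) : (k.+1 < p)%N.
      by rewrite -[p](prednK (prime_gt0 p_prime)) ltnS -dP.
    rewrite !mxE => /eqP; rewrite (eq_prim_root_expr zeta_prim) !modn_small //.
    by rewrite eqSS => /eqP/val_inj.
  by rewrite -CE det_mulmx mulf_eq0 => /norP[].
pose EP : 'M[{mpoly L[n]}]_d := map_mx (@mpolyC n L) E.
have EP_neq0 : \det EP != 0 by rewrite det_map_mx mpolyC_eq0.
pose s := \row_(k < d) map_mpoly (sigma k) f.
have NE : N *m EP = EP *m diag_mx s.
  apply/matrixP=> i k; rewrite mul_mx_diag !mxE.
  transitivity (map_mpoly (sigma k) (f * (b`_i)%:MP)); last first.
    by rewrite rmorphM /= map_mpolyC mulrC.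
  apply/mpolyP=> m; rewrite mcoeff_map_mpoly raddf_sum /=.
  rewrite (coord_vbasis (memvf (f * _)@_m)) linear_sum.
  apply: eq_bigr => j _; rewrite !mxE mulrC mcoeffCM !mcoeff_map_mpoly /=.
  by rewrite linearZ /= mulrC mulr_algl.
rewrite /ext_norm -det_map_mx -/N.
apply: (mulIf EP_neq0); rewrite -det_mulmx NE det_mulmx det_diag mulrC.
congr (_ * _); rewrite big_add1 big_mkord -dP.
by apply: eq_bigr => k _; rewrite mxE.
Qed.

End Norm.

Lemma map_mpoly_inj n (R S : nzRingType) (f : {additive R -> S}) :
  injective f -> injective (map_mpoly f : {mpoly R[n]} -> {mpoly S[n]}).
Proof.
move=> inj_f P Q PQ; apply/mpolyP=> m; apply: inj_f.
by rewrite -!mcoeff_map_mpoly PQ.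
Qed.

Lemma prod_Zp_neq0 (R : comNzRingType) p (F : nat -> R) : (1 < p)%N ->
  \prod_(i : 'Z_p | i != 0) F i = \prod_(1 <= i < p) F i.
Proof.
move=> p_gt1; rewrite -[in RHS](Zp_cast p_gt1) big_add1 /= big_mkord.
rewrite big_mkcond [LHS]big_ord_recl /= mul1r.
by apply: eq_bigr => i _.
Qed.

Theorem corollary1p4 (p : nat) (p_prime : prime p)
    (L : fieldExtType rat) (zeta : L)
    (zeta_prim : p.-primitive_root zeta) (zeta_gen : <<1; zeta>>%VS = {:L}%VS)
    (Gamma : voltage_graph 'Z_p) (v : vertex Gamma)
    (Av_neq0 : arb_sum (indet_wt (D := Gamma) rat) v != 0)
    (x : 'Z_p) :
  let A_v := arb_sum (indet_wt (D := Gamma) rat) v in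
  let A_lift := arb_sum (derived_wt (indet_wt (D := Gamma) rat))
                  ((v, x) : vertex (derived_graph Gamma)) in
  let lap := voltage_laplacian zeta Gamma in
  let q : rat := #|'Z_p|%:R^-1 in
     tofrac A_lift / tofrac A_v = tofrac (q *: ext_norm (\det lap))
  /\ map_mpoly (in_alg L) (q *: ext_norm (\det lap))
     = (q%:A : L) *: \prod_(1 <= i < p)
         \det (map_mx (map_mpoly (cycl_aut zeta i)) lap).
Proof.
move=> A_v A_lift lap q.
have Zp_eq : (Zp_trunc p).+2 = p by rewrite Zp_cast ?prime_gt1.
have card_neq0 : #|'Z_p|%:R != 0 :> rat by rewrite Num.Theory.pnatr_eq0 card_ord.
have norm_lap : map_mpoly (in_alg L) (ext_norm (\det lap))
    = \prod_(1 <= i < p) \det (map_mx (map_mpoly (cycl_aut zeta i)) lap).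
  rewrite (ext_norm_conjugates p_prime zeta_prim zeta_gen).
  by apply: eq_bigr => i _; rewrite det_map_mx.
split; last by rewrite map_mpolyZ norm_lap.
pose z : {mpoly L[#|edge Gamma|]} := zeta%:MP.
have z_prim : (Zp_trunc p).+2.-primitive_root z.
  rewrite Zp_eq; apply: (rmorph_prim_root (f := @mpolyC #|edge Gamma| L)) => //.
  exact: can_inj (@mpolyCK _ L).
have conj_lap (i : 'Z_p) : i != 0 ->
    fdet (twisted_laplacian (indet_wt L (D := Gamma)) (chi z i))
    = \det (map_mx (map_mpoly (cycl_aut zeta i)) lap).
  move=> i_neq0; congr (\det _); apply/matrixP=> j k; rewrite !mxE.
  have sigma_zeta : cycl_aut zeta i zeta = zeta ^+ i.
    apply: (cycl_autE p_prime) => //; rewrite lt0n -[X in (_ < X)%N]Zp_eq ltn_ord andbT.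
    exact: i_neq0.
  rewrite rmorphB rmorphMn !rmorph_sum /twisted_laplacian.
  under eq_bigr => e _ do rewrite mulrBr.
  rewrite sumrB; congr (_ - _).
    rewrite -mulr_suml mulr_natr (inj_eq enum_val_inj); congr (_ *+ _).
    by apply: eq_bigr => e _; rewrite /indet_wt /= map_mpolyX.
  rewrite [RHS]big_mkcondr; apply: eq_bigr => e _.
  case: (target e == _); last by rewrite mul0r mulr0.
  rewrite mul1r /= map_mpolyZ /indet_wt map_mpolyX /voltage_val rmorphXn /= sigma_zeta.
  by rewrite /chi /z -rmorphXn /= -exprM mulrC mul_mpolyC.
have lift_eq : A_lift *+ #|'Z_p| = A_v * ext_norm (\det lap).
  apply: (map_mpoly_inj (f := in_alg L)); first exact: fmorph_inj.
  rewrite rmorphMn rmorphM /= norm_lap -!arb_sum_map.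
  have wtL e : map_mpoly (in_alg L) (indet_wt rat e) = indet_wt L e :> {mpoly L[#|edge Gamma|]}.
    by rewrite /indet_wt map_mpolyX.
  have -> : (fun e => map_mpoly (in_alg L) (indet_wt (D := Gamma) rat e)) = indet_wt L.
    by apply/funext=> e; apply: wtL.
  have -> : (fun e => map_mpoly (in_alg L) (derived_wt (indet_wt (D := Gamma) rat) e))
      = derived_wt (indet_wt L).
    by apply/funext=> e; apply: wtL.
  rewrite (derived_arb_sum _ _ _ z_prim) (eq_bigr _ conj_lap); congr (_ * _).
  pose det_sigma i := \det (map_mx (map_mpoly (cycl_aut zeta i)) lap).
  exact: (prod_Zp_neq0 det_sigma (prime_gt1 p_prime)).
have -> : A_lift = A_v * (q *: ext_norm (\det lap)).
  by rewrite -scalerAr -lift_eq -scaler_nat scalerA mulVf // scale1r.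
by rewrite tofracM mulrC mulKf // tofrac_eq0.
Qed.
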